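(* Let $S^{h,n}_w\in Q_h$ and $S^{h,n}_n = 1-S^{h,n}_w$ be given at time step $n$, and let $\mathbf{u}^{h,n+1}_t$, $\boldsymbol{\xi}^{h,n+1}_c$, $p^{h,n+1}_\alpha$, $S^{h,n+1}_\alpha$ ($\alpha=w,n$) be the solution of the P-IMPES scheme (defined in the context) at time step $n+1$. Then for every $K\in\mathcal{T}_h$ the approximate saturations of both phases satisfy the local mass-conservation property on $K$: $$\int_{K} \phi\, \frac{S^{h,n+1}_\alpha - S^{h,n}_\alpha}{t_{n+1}-t_n} + \int_{\partial K} f_\alpha(S^{\ast,h,n}_{w,\alpha})\, \mathbf{u}^{h,n+1}_t\cdot \mathbf{n} = \int_K F_\alpha + \sigma_\alpha \int_{\partial K} f_n(S^{\ast,h,n}_{w,n})\, f_w(S^{\ast,h,n}_{w,w})\, \boldsymbol{\xi}^{h,n+1}_c\cdot \mathbf{n},\qquad \alpha=w,n,$$ where $\mathbf{n}$ is the unit outward normal to $\partial K$, $\sigma_w=1$, $\sigma_n=-1$, and $S^{\ast,h,n}_{w,\alpha}$ is the upwind value on each edge/face of $\partial K$ at time step $n$.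
   Context: **Model.** Incompressible immiscible two-phase flow (wetting phase $w$, non-wetting phase $n$) in $\Omega\subset\mathbb{R}^d$, $d=2,3$: for $\alpha=w,n$, $\phi\,\partial_t S_\alpha+\nabla\cdot\mathbf{u}_\alpha=F_\alpha$, $\mathbf{u}_\alpha=-\lambda_\alpha\mathbf{K}(\nabla p_\alpha+\rho_\alpha g\nabla z)$, $S_n+S_w=1$, $p_c(S_w)=p_n-p_w$. Here $\phi$ is the porosity (time-independent, uniformly bounded below and above), $\mathbf{K}$ is the symmetric positive definite absolute permeability tensor, $\rho_\alpha$ the densities, $g$ the gravitational acceleration, $z$ the depth, $F_\alpha$ the source/sink terms, $F_t=F_w+F_n$, $p_c$ the capillary pressure function, and $\lambda_\alpha=\lambda_\alpha(S_w)$ the phase mobilities. $\lambda_t=\lambda_w+\lambda_n$ and $f_\alpha=\lambda_\alpha/\lambda_t$, so $f_w+f_n=1$. There are positive constants with $0\le\lambda_\alpha(S_w)\le\overline{\lambda}_\alpha$, $0<\lambda_t(S_w)\le\overline{\lambda}_t$. The boundary is $\Gamma=\partial\Omega=\Gamma_D\cup\Gamma_N$ (disjoint), with $p_\alpha=p^B_\alpha$ on $\Gamma_D$, $\mathbf{u}_\alpha\cdot\mathbf{n}=g^N_\alpha$ on $\Gamma_N$, and $S_\alpha=S^B_\alpha$ on the inflow boundary $\Gamma_{\rm in}=\{\mathbf{x}\in\Gamma:\mathbf{u}_t\cdot\mathbf{n}<0\}$, $\mathbf{u}_t=\mathbf{u}_w+\mathbf{u}_n$. **Spaces.** $\mathcal{T}_h$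 is a quasi-uniform simplicial mesh of $\Omega$. $\mathbf{U}_h=RT_0(\mathcal{T}_h)$ is the lowest-order Raviart–Thomas space (on each $K$, $\mathbf{v}=\mathbf{a}+b\mathbf{x}$ with $\mathbf{a}\in\mathbb{R}^d$, $b\in\mathbb{R}$, and normal components continuous across interior edges/faces), $\mathbf{U}^0_h=\{\mathbf{v}\in\mathbf{U}_h:\mathbf{v}\cdot\mathbf{n}=0\text{ on }\Gamma_N\}$, and $Q_h$ is the space of piecewise constants on $\mathcal{T}_h$. $(\cdot,\cdot)$ is the $L^2(\Omega)$ inner product. **Upwind values.** Let $\mathbf{u}^{h,n}_\alpha$ be the discrete velocity of phase $\alpha$ available at time step $n$ (computed elementwise by $\mathbf{u}^h_w=f_w\mathbf{u}^h_t-f_wf_n\boldsymbol{\xi}^h_c$, $\mathbf{u}^h_n=f_n\mathbf{u}^h_t+f_wf_n\boldsymbol{\xi}^h_c$), and let $\{\cdot\}$ denote the average across an interior edge/face. On $\gamma=\partial K_i\cap\partial K_j$ with unit normal $\mathbf{n}_\gamma$ exterior to $K_i$, put $S^{\ast,h,n}_\alpha=S^{h,n}_\alpha|_{K_i}$ if $\{\mathbf{u}^{h,n}_\alpha\cdot\mathbf{n}_\gamma\}\ge0$ and $S^{\ast,h,n}_\alpha=S^{h,n}_\alpha|_{K_j}$ otherwise; then $S^{\ast,h,n}_{w,w}=S^{\ast,h,n}_w$ and $S^{\ast,h,n}_{w,n}=1-S^{\ast,h,n}_n$. On $\gamma\subset\Gamma_{\rm in}$, $S^{\ast,h,n}_{w,\alpha}$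 is the $L^2$-projection of $S^B_w$ onto constants on $\gamma$; on other boundary edges/faces it is the value $S^{h,n}_w$ of the adjacent element. **Forms.** For $\mathbf{v}\in\mathbf{U}_h$, $q\in Q_h$: $$B_\alpha(\mathbf{v},q;S^{h,n}_w)=\sum_{K\in\mathcal{T}_h}\int_{\partial K}f_\alpha(S^{\ast,h,n}_{w,\alpha})\,\mathbf{v}\cdot\mathbf{n}\,q,\qquad B_c(\mathbf{v},q;S^{h,n}_w)=\sum_{K\in\mathcal{T}_h}\int_{\partial K}f_n(S^{\ast,h,n}_{w,n})f_w(S^{\ast,h,n}_{w,w})\,\mathbf{v}\cdot\mathbf{n}\,q,$$ with $q$ on $\partial K$ taken from inside $K$. **P-IMPES scheme.** Given $S^{h,n}_w$, find $\mathbf{u}^{h,n+1}_t,\boldsymbol{\xi}^{h,n+1}_c\in\mathbf{U}_h$, $p^{h,n+1}_\alpha,S^{h,n+1}_\alpha\in Q_h$ ($\alpha=w,n$) such that for all $\mathbf{v}\in\mathbf{U}^0_h$, $q\in Q_h$ (with $\lambda_t,f_w,f_n$ evaluated at $S^{h,n}_w$ in the second and third equations): 1. $\big(\phi\frac{S^{h,n+1}_\alpha-S^{h,n}_\alpha}{t_{n+1}-t_n},q\big)+B_\alpha(\mathbf{u}^{h,n+1}_t,q;S^{h,n}_w)=(F_\alpha,q)+\sigma_\alpha B_c(\boldsymbol{\xi}^{h,n+1}_c,q;S^{h,n}_w)$, $\alpha=w,n$, with $\sigma_w=1,\sigma_n=-1$; 2. $((\lambda_t\mathbf{K})^{-1}\mathbf{u}^{h,n+1}_t,\mathbf{v})-(p^{h,n+1}_w,\nabla\cdot\mathbf{v})=((\lambda_t\mathbf{K})^{-1}f_n\boldsymbol{\xi}^{h,n+1}_c,\mathbf{v})-\int_{\Gamma_D}p^B_w\mathbf{v}\cdot\mathbf{n}-(\rho_wg\nabla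 z,\mathbf{v})$; 3. $((\lambda_t\mathbf{K})^{-1}\mathbf{u}^{h,n+1}_t,\mathbf{v})-(p^{h,n+1}_n,\nabla\cdot\mathbf{v})=-((\lambda_t\mathbf{K})^{-1}f_w\boldsymbol{\xi}^{h,n+1}_c,\mathbf{v})-\int_{\Gamma_D}p^B_n\mathbf{v}\cdot\mathbf{n}-(\rho_ng\nabla z,\mathbf{v})$; 4. $(S^{h,n+1}_n+S^{h,n+1}_w,q)=(1,q)$; 5. $(p^{h,n+1}_n-p^{h,n+1}_w,q)=(p_c(S^{h,n}_w),q)$. *)

(* Defs.v *)
From HB Require Import structures.
From mathcomp Require Import all_boot all_order all_algebra.
From mathcomp Require Import all_classical all_reals all_analysis.
Set Implicit Arguments.
Unset Strict Implicit.
Unset Printing Implicit Defensive.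
Import Order.TTheory GRing.Theory Num.Theory.
Import numFieldNormedType.Exports.
Local Open Scope classical_set_scope.
Local Open Scope ring_scope.

(* The library has no Lebesgue measure on R^n: 'rV[R]_n gets the sigma-algebra
   generated by the coordinates, and lebesgue_rV n is the n-fold product of
   lebesgue_measure, transported along rV_cons (see lebesgue_rV_box). *)
Section measurable_rV.
Context (R : realType) (n : nat).
Let coord (i : 'I_n) (x : 'rV[R]_n) : measurableTypeR R := x ord0 i.
Let rV_set0 : g_sigma_preimage coord set0.
Proof. exact: sigma_algebra0. Qed.
Let rV_setC A : g_sigma_preimage coord A -> g_sigma_preimage coord (~` A).
Proof. exact: sigma_algebraC. Qed.
Let rV_bigcup (F : (set 'rV[R]_n)^nat) :
  (forall i, g_sigma_preimage coord (F i)) ->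
  g_sigma_preimage coord (\bigcup_i (F i)).
Proof. exact: sigma_algebra_bigcup. Qed.

HB.instance Definition _ := @isMeasurable.Build
  (measure_tuple_display default_measure_display) 'rV[R]_n
  (g_sigma_preimage coord) rV_set0 rV_setC rV_bigcup.
End measurable_rV.

Section lebesgue_rV.
Context {R : realType}.

Definition rV_cons n (p : measurableTypeR R * 'rV[R]_n) : 'rV[R]_n.+1 :=
  \row_i oapp (fun j => p.2 ord0 j) p.1 (unlift ord0 i).

Lemma measurable_rV_cons n : measurable_fun setT (@rV_cons n).
Proof.
move=> _ A mA; rewrite setTI.
pose T := (measurableTypeR R * 'rV[R]_n)%type.
pose G := [set B : set 'rV[R]_n.+1 | measurable (@rV_cons n @^-1` B : set T)].
suff : measurable `<=` G by exact.
apply: smallest_sub.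
  split => [|B GB|F GF]; rewrite /G /=.
  - by rewrite preimage_set0.
  - by rewrite setTD preimage_setC; exact: measurableC.
  - by rewrite preimage_bigcup; exact: bigcupT_measurable.
rewrite -bigcup_mkord_ord; apply: bigcup_sub => i lin B [C mC <-].
rewrite /G/= setTI -comp_preimage.
case: (unliftP ord0 (inord i : 'I_n.+1)) => [j|] ->.
  rewrite (_ : _ \o _ = (fun x : 'rV[R]_n => x ord0 j : measurableTypeR R) \o snd).
    rewrite comp_preimage -[X in measurable X]setTI.
    apply: measurable_snd => //.
    apply: sub_sigma_algebra; rewrite -bigcup_seq/=; exists j.
      by rewrite /= mem_index_enum.
    by exists C => //; rewrite setTI.
  by apply/funext => p /=; rewrite mxE liftK.
rewrite (_ : _ \o _ = fst).
  by rewrite -[X in measurable X]setTI; exact: measurable_fst.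
by apply/funext => p /=; rewrite mxE unlift_none.
Qed.

Section step.
Context (n : nat) (m : {sigma_finite_measure set 'rV[R]_n -> \bar R}).

Definition lebesgue_rV_step : set 'rV[R]_n.+1 -> \bar R :=
  pushforward ((@lebesgue_measure R) \x m)%E (@rV_cons n).

Let m0 : lebesgue_rV_step set0 = 0%E.
Proof. by rewrite /lebesgue_rV_step /pushforward preimage_set0 measure0. Qed.
Let m_ge0 A : (0 <= lebesgue_rV_step A)%E.
Proof. by rewrite /lebesgue_rV_step /pushforward measure_ge0. Qed.
Let m_sigma : semi_sigma_additive lebesgue_rV_step.
Proof.
move=> F mF tF mUF; rewrite /lebesgue_rV_step /pushforward preimage_bigcup.
have mc B : measurable B -> measurable (@rV_cons n @^-1` B).
  by move=> mB; rewrite -[X in measurable X]setTI; exact: measurable_rV_cons.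
apply: measure_semi_sigma_additive.
- by move=> k; exact: mc.
- apply/trivIsetP => /= i j _ _ ij; rewrite -preimage_setI.
  by move/trivIsetP : tF => /(_ _ _ _ _ ij) ->//; rewrite preimage_set0.
- by rewrite -preimage_bigcup; exact: mc.
Qed.
HB.instance Definition _ := isMeasure.Build _ _ _ lebesgue_rV_step
  m0 m_ge0 m_sigma.

Lemma sigma_finite_lebesgue_rV_step : sigma_finite setT lebesgue_rV_step.
Proof.
pose un (x : 'rV[R]_n.+1) : measurableTypeR R * 'rV[R]_n :=
  (x ord0 ord0, \row_j x ord0 (lift ord0 j)).
have unK p : un (rV_cons p) = p.
  case: p => a b; rewrite /un /rV_cons; congr pair; rewrite ?mxE ?unlift_none//.
  by apply/rowP => j; rewrite !mxE liftK.
have mcoord k (i : 'I_k) : measurable_fun setT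
    (fun x : 'rV[R]_k => x ord0 i : measurableTypeR R).
  move=> _ B mB; rewrite setTI; apply: sub_sigma_algebra.
  rewrite -bigcup_seq/=; exists i; first by rewrite /= mem_index_enum.
  by exists B => //; rewrite setTI.
have mun : measurable_fun setT un.
  apply/measurable_fun_pairP; split; first exact: mcoord.
  move=> _ A mA; rewrite setTI.
  pose G := [set B : set 'rV[R]_n | measurable ((snd \o un) @^-1` B)].
  suff : measurable `<=` G by exact.
  apply: smallest_sub.
    split => [|B GB|F GF]; rewrite /G /=.
    - by rewrite preimage_set0.
    - by rewrite setTD preimage_setC; exact: measurableC.
    - by rewrite preimage_bigcup; exact: bigcupT_measurable.
  move=> B; rewrite -bigcup_seq => -[i _ [C mC <-]].
  rewrite /G/= setTI -comp_preimage -[X in measurable X]setTI.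
  rewrite (_ : _ \o _ = fun x : 'rV[R]_n.+1 => x ord0 (lift ord0 i)).
    exact: mcoord.
  by apply/funext => x /=; rewrite mxE.
have /sigma_finiteP[F [TF ndF Foo]] := sigma_finiteT (@lebesgue_measure R).
have /sigma_finiteP[G [TG ndG Goo]] := sigma_finiteT m.
exists (fun k => un @^-1` (F k `*` G k)).
  rewrite -preimage_bigcup (_ : \bigcup_k _ = setT) ?preimage_setT//.
  apply/seteqP; split => // -[x y] _.
  have [i _ Fx] : (\bigcup_k F k) x by rewrite -TF.
  have [j _ Gy] : (\bigcup_k G k) y by rewrite -TG.
  exists (maxn i j) => //; split => /=.
    by move: x Fx; exact/subsetPset/ndF/leq_maxl.
  by move: y Gy; exact/subsetPset/ndG/leq_maxr.
move=> k; have [mF Fk] := Foo k; have [mG Gk] := Goo k; split.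
  by rewrite -[X in measurable X]setTI; apply: mun => //; exact: measurableX.
rewrite /lebesgue_rV_step /pushforward -comp_preimage.
rewrite (_ : _ \o _ = id); last by apply/funext => p /=; rewrite unK.
by rewrite preimage_id product_measure1E// lte_mul_pinfty// ge0_fin_numE.
Qed.
HB.instance Definition _ := Measure_isSigmaFinite.Build _ _ _ lebesgue_rV_step
  sigma_finite_lebesgue_rV_step.
End step.

Fixpoint lebesgue_rV n : {sigma_finite_measure set 'rV[R]_n -> \bar R} :=
  match n with
  | 0 => \d_(0 : 'rV[R]_0)
  | k.+1 => lebesgue_rV_step (lebesgue_rV k)
  end.

Lemma lebesgue_rV_box n (A : 'I_n -> set (measurableTypeR R)) :
  (forall i, measurable (A i)) ->
  lebesgue_rV n [set x : 'rV[R]_n | forall i, A i (x ord0 i)] =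
  (\prod_(i < n) lebesgue_measure (A i))%E.
Proof.
elim: n A => [|n IH] A mA.
  rewrite big_ord0 /= diracE mem_set//.
  by case.
have mB : measurable
    [set x : 'rV[R]_n | forall i, A (lift ord0 i) (x ord0 i)].
  rewrite (_ : mkset _ = \bigcap_(i in [set: 'I_n])
     [set x : 'rV[R]_n | A (lift ord0 i) (x ord0 i)]); last first.
    by apply/seteqP; split => x /= h i; [move=> _|]; exact: h.
  apply: fin_bigcap_measurable => // i _.
  apply: sub_sigma_algebra; rewrite -bigcup_seq/=; exists i.
    by rewrite /= mem_index_enum.
  by exists (A (lift ord0 i)) => //; rewrite setTI.
rewrite big_ord_recl /= /lebesgue_rV_step /pushforward -IH//.
rewrite -product_measure1E//.
congr (_ _).
apply/seteqP; split => [[a b] /= h|[a b] /= [h1 h2] i].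
  split; first by have := h ord0; rewrite mxE unlift_none.
  by move=> i; have := h (lift ord0 i); rewrite mxE liftK.
by rewrite mxE; case: unliftP => [j|] ->.
Qed.
End lebesgue_rV.

Section geometry.
Context {R : realType}.

Definition dot d (u v : 'rV[R]_d) : R := \sum_i u ord0 i * v ord0 i.

(* The library norm on 'rV[R]_d is the sup norm. *)
Definition enorm d (u : 'rV[R]_d) : R := Num.sqrt (dot u u).

Definition gradient d (z : 'rV[R]_d.+1 -> R) (x : 'rV[R]_d.+1) : 'rV[R]_d.+1 :=
  \row_i 'D_(delta_mx ord0 i) z x.

Definition divergence d (v : 'rV[R]_d.+1 -> 'rV[R]_d.+1) (x : 'rV[R]_d.+1) : R :=
  \tr (jacobian v x).

Definition open_simplex k d (p : 'I_k.+1 -> 'rV[R]_d) : set 'rV[R]_d :=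
  [set x | exists l : 'I_k.+1 -> R,
    [/\ forall i, 0 < l i, \sum_i l i = 1 & x = \sum_i l i *: p i]].

Definition closed_simplex k d (p : 'I_k.+1 -> 'rV[R]_d) : set 'rV[R]_d :=
  [set x | exists l : 'I_k.+1 -> R,
    [/\ forall i, 0 <= l i, \sum_i l i = 1 & x = \sum_i l i *: p i]].

Definition edge_mx k d (p : 'I_k.+1 -> 'rV[R]_d) : 'M[R]_(k, d) :=
  \matrix_i (p (lift ord0 i) - p ord0).

Definition ref_simplex k : set 'rV[R]_k :=
  [set t | (forall i, 0 < t ord0 i) /\ \sum_i t ord0 i < 1].

(* Integral over a k-simplex of R^d for the k-dimensional surface measure,
   through the affine parametrization t |-> p_0 + t E by the reference simplex;
   sqrt (det (E E^T)) is the Gram factor of that parametrization. *)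
Definition simplex_integral k d (p : 'I_k.+1 -> 'rV[R]_d) (f : 'rV[R]_d -> R) : R :=
  Num.sqrt (\det (edge_mx p *m (edge_mx p)^T)) *
  \int[lebesgue_rV k]_(t in @ref_simplex k) f (p ord0 + t *m edge_mx p).

Definition frontier d (A : set 'rV[R]_d) : set 'rV[R]_d :=
  closure A `\` interior A.

End geometry.

(* Throughout, the space dimension is d = m.+1, so that faces are m-simplices. *)
Record mesh (R : realType) (m : nat) := Mesh {
  elt : finType;
  vert : elt -> 'I_m.+2 -> 'rV[R]_m.+1 }.

Section mesh_theory.
Context {R : realType} {m : nat}.
Notation pt := 'rV[R]_m.+1.
Variables (Omega : set pt) (T : mesh R m).
Implicit Types (K L : elt T) (i j : 'I_m.+2).

(* Elements are open simplices and faces relatively open ones; face (K, i) is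
   the face of K opposite to its vertex i. *)
Definition elem K : set pt := open_simplex (vert K).

Definition face_vert K i (j : 'I_m.+1) : pt := vert K (lift i j).

Definition face K i : set pt := open_simplex (face_vert K i).

Definition common_face K L : set pt :=
  [set x | exists l : 'I_m.+2 -> R,
    [/\ forall i, 0 <= l i, \sum_i l i = 1, x = \sum_i l i *: vert K i &
        forall i, l i != 0 -> exists j, vert K i = vert L j]].

Definition simplicial_mesh : Prop :=
  [/\ forall K, \det (edge_mx (vert K)) != 0,
      forall K, elem K `<=` Omega,
      closure Omega = \bigcup_(K in [set: elt T]) closed_simplex (vert K),
      forall K L, K != L -> elem K `&` elem L = set0 &
      forall K L, closed_simplex (vert K) `&` closed_simplex (vert L) =
                  common_face K L].

(* h <= c * rho_K for all K, where h is the mesh size and K contains a ball of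
   radius rho_K. *)
Definition quasi_uniform (c : R) : Prop :=
  forall K, exists (x0 : pt) (r : R),
    [/\ 0 < r, (forall x, enorm (x - x0) < r -> elem K x) &
        forall L x y, elem L x -> elem L y -> enorm (x - y) <= c * r].

Definition bdry_face K i : Prop := face K i `<=` frontier Omega.

(* (K, i) and (L, j) are the same interior face, seen from its two sides. *)
Definition interface K i L j : Prop :=
  [/\ K != L, face K i = face L j & face K i `<=` Omega].

Definition outward_normal K i : set pt :=
  [set nu | [/\ dot nu nu = 1,
    forall j j' : 'I_m.+1, dot nu (face_vert K i j - face_vert K i j') = 0 &
    forall j : 'I_m.+1, dot nu (vert K i - face_vert K i j) < 0]].

Definition out_normal K i : pt := xget 0 (outward_normal K i).

Definition face_integral K i (f : pt -> R) : R :=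
  simplex_integral (face_vert K i) f.

(* The integrand on the boundary of K is given face by face. *)
Definition bd_integral K (f : 'I_m.+2 -> pt -> R) : R :=
  \sum_i face_integral K i (f i).

(* A piecewise field is given by its restrictions to the elements (so that its
   traces from inside each element make sense), a piecewise constant by its
   values; pwc, pwv, pwdiv are the functions on Omega they define, almost
   everywhere. *)
Definition Qh := elt T -> R.
Definition pwfield := elt T -> pt -> pt.

Definition pwc (q : Qh) (x : pt) : R := \sum_K q K * \1_(elem K) x.
Definition pwv (v : pwfield) (x : pt) : pt := \sum_K \1_(elem K) x *: v K x.
Definition pwdiv (v : pwfield) (x : pt) : R :=
  \sum_K divergence (v K) x * \1_(elem K) x.

Definition RT0 (v : pwfield) : Prop :=
  (forall K, exists (a : pt) (b : R), forall x, v K x = a + b *: x) /\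
  (forall K i L j, interface K i L j ->
     forall x, face K i x -> dot (v K x) (out_normal K i) = dot (v L x) (out_normal K i)).

Definition RT0_0 (GammaN : set pt) (v : pwfield) : Prop :=
  RT0 v /\
  (forall K i x, bdry_face K i -> face K i x -> GammaN x ->
     dot (v K x) (out_normal K i) = 0).

Definition inner (f g : pt -> R) : R :=
  \int[lebesgue_rV m.+1]_(x in Omega) (f x * g x).

Definition vinner (u v : pt -> pt) : R :=
  \int[lebesgue_rV m.+1]_(x in Omega) dot (u x) (v x).

(* The L^2(gamma)-projection onto the constants on the face gamma = (K, i). *)
Definition face_proj K i (f : pt -> R) : R :=
  xget 0 [set c | forall r : R, face_integral K i (fun x => (f x - c) * r) = 0].

End mesh_theory.

Arguments elem {R m T} K _.
Arguments face {R m T} K i _.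
Arguments out_normal {R m T} K i.

Variant phase := wet | nonwet.

Definition other (a : phase) := if a is wet then nonwet else wet.

(* Data of the two-phase flow problem; the time-dependent ones are taken at the
   time step under consideration. SB is the inflow saturation; velocity holds the
   phase velocities whose sum determines the inflow part of the boundary. *)
Record flow_data (R : realType) (m : nat) := FlowData {
  porosity : 'rV[R]_m.+1 -> R;
  perm : 'rV[R]_m.+1 -> 'M[R]_m.+1;
  density : phase -> R;
  gravity : R;
  depth : 'rV[R]_m.+1 -> R;
  source : phase -> 'rV[R]_m.+1 -> R;
  mobility : phase -> R -> R;
  pcap : R -> R;
  GammaD : set 'rV[R]_m.+1;
  GammaN : set 'rV[R]_m.+1;
  pB : phase -> 'rV[R]_m.+1 -> R;
  SB : phase -> 'rV[R]_m.+1 -> R;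
  velocity : phase -> 'rV[R]_m.+1 -> 'rV[R]_m.+1 }.

Section scheme.
Context {R : realType} {m : nat}.
Notation pt := 'rV[R]_m.+1.
Variables (Omega : set pt) (D : flow_data R m) (T : mesh R m).
Implicit Types (K L : elt T) (i j : 'I_m.+2) (a : phase).

Definition lambda_t (s : R) : R := mobility D wet s + mobility D nonwet s.
Definition frac_flow a (s : R) : R := mobility D a s / lambda_t s.

Definition admissible_data : Prop :=
  [/\ open Omega /\ bounded_set Omega,
      GammaD D `|` GammaN D = frontier Omega /\ GammaD D `&` GammaN D = set0,
      exists lo hi : R, 0 < lo /\
        forall x, Omega x -> lo <= porosity D x <= hi,
      forall x, Omega x -> (perm D x)^T = perm D x /\
        forall v : pt, v != 0 -> 0 < dot (v *m perm D x) v &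
      (forall x, Omega x -> differentiable (depth D) x) /\
      exists (lmax : phase -> R) (ltmax : R),
        [/\ forall a, 0 < lmax a, 0 < ltmax,
            forall a s, 0 <= mobility D a s <= lmax a &
            forall s, 0 < lambda_t s <= ltmax]].

Definition total_velocity (x : pt) : pt := velocity D wet x + velocity D nonwet x.

Definition Gamma_in : set pt :=
  [set x | exists K i, [/\ bdry_face Omega K i, face K i x &
                           dot (total_velocity x) (out_normal K i) < 0]].

Definition phase_velocity (Sr : Qh T) (ut xi : pwfield T) a : pwfield T :=
  fun K x =>
  if a is wet then
    frac_flow wet (Sr K) *: ut K x - (frac_flow wet (Sr K) * frac_flow nonwet (Sr K)) *: xi K x
  else
    frac_flow nonwet (Sr K) *: ut K x + (frac_flow wet (Sr K) * frac_flow nonwet (Sr K)) *: xi K x.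

(* Upwind value at a point x of the interface of K and L, whose unit normal nu
   is exterior to K. *)
Definition upwind (S : Qh T) (u : pwfield T) K L (nu x : pt) : R :=
  if 0 <= dot (2^-1 *: (u K x + u L x)) nu then S K else S L.

(* The definition of the upwind value singles out one of the two sides of an
   interface (this matters when the average normal velocity vanishes): for
   neighbours K, L, the distinguished element is K if first K L and L
   otherwise. *)
Definition orientation (first : rel (elt T)) : Prop :=
  forall K L, K != L -> first K L = ~~ first L K.

Section upwind_values.
Variables (first : rel (elt T)) (S : phase -> Qh T) (u : phase -> pwfield T).

Definition S_upw a K i L j (x : pt) : R :=
  if first K L then upwind (S a) (u a) K L (out_normal K i) x
  else upwind (S a) (u a) L K (out_normal L j) x.

(* S_{w,a}^* at the point x of the face (K, i). *)
Definition Sw_upw a K i (x : pt) : R :=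
  if [pick Lj : elt T * 'I_m.+2 | `[< interface Omega K i Lj.1 Lj.2 >]]
    is Some (L, j)
  then if a is wet then S_upw wet K i L j x else 1 - S_upw nonwet K i L j x
  else if `[< bdry_face Omega K i /\ face K i `<=` Gamma_in >]
       then face_proj K i (SB D wet)
       else S wet K.

Definition flux a (v : pwfield T) K i (x : pt) : R :=
  frac_flow a (Sw_upw a K i x) * dot (v K x) (out_normal K i).

Definition cflux (v : pwfield T) K i (x : pt) : R :=
  frac_flow nonwet (Sw_upw nonwet K i x) * frac_flow wet (Sw_upw wet K i x) *
  dot (v K x) (out_normal K i).

Definition B_form a (v : pwfield T) (q : Qh T) : R :=
  \sum_K bd_integral K (fun i x => flux a v K i x * q K).

Definition Bc_form (v : pwfield T) (q : Qh T) : R :=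
  \sum_K bd_integral K (fun i x => cflux v K i x * q K).

End upwind_values.

Definition phase_sign a : R := if a is wet then 1 else -1.

Definition dirichlet_term a (v : pwfield T) : R :=
  \sum_K \sum_(i | `[< bdry_face Omega K i >])
    face_integral K i (fun x =>
      pB D a x * dot (v K x) (out_normal K i) * \1_(GammaD D) x).

(* x |-> (lambda_t(S_w^h) K)^-1 w(x); perm D x acts on column vectors. *)
Definition resist (S : Qh T) (w : pt -> pt) (x : pt) : pt :=
  (invmx (lambda_t (pwc S x) *: perm D x) *m (w x)^T)^T.

Definition P_IMPES (first : rel (elt T)) (t0 t1 : R)
    (S0 : phase -> Qh T) (u0 : phase -> pwfield T)
    (ut xi : pwfield T) (p S1 : phase -> Qh T) : Prop :=
  [/\ RT0 Omega ut /\ RT0 Omega xi,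
    forall a (q : Qh T),
      inner Omega
        (fun x => porosity D x * ((pwc (S1 a) x - pwc (S0 a) x) / (t1 - t0)))
        (pwc q)
      + B_form first S0 u0 a ut q
      = inner Omega (source D a) (pwc q) + phase_sign a * Bc_form first S0 u0 xi q,
    forall a (v : pwfield T), RT0_0 Omega (GammaN D) v ->
      vinner Omega (resist (S0 wet) (pwv ut)) (pwv v)
      - inner Omega (pwc (p a)) (pwdiv v)
      = phase_sign a * vinner Omega
          (resist (S0 wet)
             (fun x => frac_flow (other a) (pwc (S0 wet) x) *: pwv xi x)) (pwv v)
        - dirichlet_term a v
        - vinner Omega
            (fun x => (density D a * gravity D) *: gradient (depth D) x) (pwv v),
    forall q : Qh T,
      inner Omega (fun x => pwc (S1 nonwet) x + pwc (S1 wet) x) (pwc q)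
      = inner Omega (fun=> 1) (pwc q) &
    forall q : Qh T,
      inner Omega (fun x => pwc (p nonwet) x - pwc (p wet) x) (pwc q)
      = inner Omega (fun x => pcap D (pwc (S0 wet) x)) (pwc q)].

End scheme.

(* Main.v *)
Require Import Defs.
From mathcomp Require Import all_boot all_order all_algebra.
From mathcomp Require Import all_classical all_reals all_analysis.
Import Order.TTheory GRing.Theory Num.Theory.
Import numFieldNormedType.Exports.
Local Open Scope classical_set_scope.
Local Open Scope ring_scope.

(** The balance law on an element K is the saturation equation of the scheme
    tested with the indicator q of K, which is an admissible test function
    because piecewise constants on the mesh are unconstrained across faces.
    Both kinds of terms localize to K: a volume integral over Omega of
    something times q is the integral over K, since K lies inside Omega
    ([inner_test_elem]); and a sum over all elements of boundary integrals
    weighted by q keeps only the boundary of K, since q is read from inside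
    each element, so that a neighbour of K contributes nothing on the face it
    shares with K ([sum_bd_integral_test_elem]). *)

Section test_elem.
Context {R : realType} {m : nat} (T : mesh R m).
Implicit Types K L : elt T.

Definition test_elem K : Qh T := fun L => (L == K)%:R.

Lemma pwc_test_elem K x : pwc (test_elem K) x = \1_(elem K) x.
Proof.
rewrite /pwc (bigD1 K)//= big1 ?addr0 /test_elem ?eqxx ?mul1r// => L LK.
by rewrite (negbTE LK) mul0r.
Qed.

(** An integral over a set is by construction that of the integrand extended
    by zero, and the extensions of the two integrands are the same function. *)
Lemma inner_test_elem (Omega : set 'rV[R]_m.+1) K f : elem K `<=` Omega ->
  inner Omega f (pwc (test_elem K)) =
  \int[lebesgue_rV m.+1]_(x in elem K) f x.
Proof.
move=> KO; rewrite /inner /Rintegral integral_mkcond [in RHS]integral_mkcond.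
congr (fine (integral _ _ _)); apply/funext => x.
rewrite /patch pwc_test_elem indicE.
have [xK|xK] := boolP (x \in elem K).
  by rewrite mem_set ?mulr1//; apply: KO; exact: set_mem.
by rewrite mulr0; case: ifP.
Qed.

Lemma bd_integral0 K : bd_integral K (fun _ _ => 0) = 0.
Proof.
rewrite /bd_integral big1// => i _.
by rewrite /face_integral /simplex_integral /Rintegral integral0 mulr0.
Qed.

Lemma sum_bd_integral_test_elem K (f : elt T -> 'I_m.+2 -> 'rV[R]_m.+1 -> R) :
  \sum_L bd_integral L (fun i x => f L i x * test_elem K L) =
  bd_integral K (f K).
Proof.
rewrite (bigD1 K)//= big1 ?addr0 => [|L LK]; rewrite /test_elem.
  rewrite eqxx; congr (bd_integral K _).
  by apply/funext => i; apply/funext => x; rewrite mulr1.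
rewrite (negbTE LK) -[RHS](bd_integral0 L); congr (bd_integral L _).
by apply/funext => i; apply/funext => x; rewrite mulr0.
Qed.

End test_elem.

Theorem lemma4p1 (R : realType) (m : nat) (hd : m.+1 = 2%N \/ m.+1 = 3%N)
    (Omega : set 'rV[R]_m.+1) (D : flow_data R m)
    (hD : admissible_data Omega D)
    (T : mesh R m) (hT : simplicial_mesh Omega T)
    (c : R) (hc : quasi_uniform T c)
    (first : rel (elt T)) (hfirst : orientation first)
    (t0 t1 : R) (ht : t0 < t1)
    (S0 : phase -> Qh T) (hS0 : forall K, S0 nonwet K = 1 - S0 wet K)
    (Sr : Qh T) (ut0 xi0 : pwfield T)
    (hut0 : RT0 Omega ut0) (hxi0 : RT0 Omega xi0)
    (ut xi : pwfield T) (p S1 : phase -> Qh T)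
    (hsol : P_IMPES Omega D first t0 t1 S0 (phase_velocity D Sr ut0 xi0)
              ut xi p S1) :
  let u0 := phase_velocity D Sr ut0 xi0 in
  forall (K : elt T) (a : phase),
    \int[lebesgue_rV m.+1]_(x in elem K)
      (porosity D x * ((pwc (S1 a) x - pwc (S0 a) x) / (t1 - t0)))
    + bd_integral K (fun i x =>
        frac_flow D a (Sw_upw Omega D first S0 u0 a K i x)
        * dot (ut K x) (out_normal K i))
    = \int[lebesgue_rV m.+1]_(x in elem K) source D a x
      + phase_sign a * bd_integral K (fun i x =>
          frac_flow D nonwet (Sw_upw Omega D first S0 u0 nonwet K i x)
          * frac_flow D wet (Sw_upw Omega D first S0 u0 wet K i x)
          * dot (xi K x) (out_normal K i)).
Proof.
move=> u0 K a; have [_ elemO _ _ _] := hT.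
have [_ /(_ a (test_elem T K)) + _ _ _] := hsol.
rewrite !inner_test_elem; [|exact: elemO..].
by rewrite /B_form /Bc_form !sum_bd_integral_test_elem.
Qed.
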